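(* Consider the linear stochastic system, the open-loop problem and the closed-loop indirect-feedback MPC algorithm described in the context. Assume that the following holds. (i) The set $\mathbb{Z}_f\subseteq\mathbb{R}^n$ is nonempty, and for all $z\in\mathbb{Z}_f$ and $i=1,\ldots,m_x$: $c_i^\top z\le p_i-\sup_{j\in\mathbb{N}_0}\rho(c_i^\top E_j)$. (ii) There exists $v_f\in\mathbb{V}$ such that for all $z\in\mathbb{Z}_f$: $(A+BK)z+Bv_f+\mathbb{E}[W(0)]\in\mathbb{Z}_f$, and $d_i^\top(Kz+v_f)\le q_i-\sup_{j\in\mathbb{N}_0}\rho(d_i^\top KE_j)$ for $i=1,\ldots,m_u$. If the open-loop problem is feasible at time $j=0$, i.e. for the initial condition $z_0=\mathbb{E}[X_0]$, $E_0=X_0-z_0$, then the algorithm is recursively feasible: for all times $j\in\mathbb{N}_0$ (and every realization $\omega$) the open-loop problem with data $(x_j,z_j,E_j)=(X^{cl}(j,\omega),Z^{cl}(j,\omega),E_j)$ is feasible.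
   Context: Setting. $(\Omega,\mathcal{F},\mathbb{P})$ is a probability space and $\mathcal{R}(\Omega,\mathcal{Y})$ is the set of $\mathcal{Y}$-valued random variables. $A\in\mathbb{R}^{n\times n}$, $B\in\mathbb{R}^{n\times l}$, $(A,B)$ controllable. The system is $X(k+1)=AX(k)+BU(k)+W(k)$, $X(0)=X_0\in\mathcal{R}(\Omega,\mathbb{R}^n)$, where $W(0),W(1),\ldots$ are i.i.d. $\mathbb{R}^n$-valued random variables with finite mean (not necessarily Gaussian), $\mathcal{F}_k=\sigma(X(0),\ldots,X(k))$, controls are adapted ($\sigma(U(k))\subseteq\mathcal{F}_k$), and $W(k)$ is independent of $X(k)$ and of every admissible (i.e. $\mathcal{F}_k$-measurable) $U(k)$. The stage cost is $\ell(X,U)=\mathbb{E}[g(X,U)]$ with $g:\mathbb{R}^n\times\mathbb{R}^l\to\mathbb{R}$ continuous and bounded from below; the terminal cost is $F(X)=\mathbb{E}[g_f(X)]$ with $g_f:\mathbb{R}^n\to\mathbb{R}$. Risk measure. $\rho:\mathcal{R}(\Omega,\mathbb{R})\to\mathbb{R}\cup\{+\infty\}$ is translative ($\rho(Y+c)=\rho(Y)+c$ for $c\in\mathbb{R}$), monotone ($\rho(Y_1)\ge\rho(Y_2)$ if $Y_1\ge Y_2$ a.s.) and law-invariant ($\rho(Y)=\rho(Z)$ if $Y\sim Z$). Given are $c_i\in\mathbb{R}^n$, $p_i\in\mathbb{R}$ ($i=1,\ldots,m_x$) and $d_i\in\mathbb{R}^l$, $q_i\in\mathbb{R}$ ($i=1,\ldots,m_u$).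 Open-loop problem. Fix a stabilizing gain $K\in\mathbb{R}^{l\times n}$ (all eigenvalues of $A+BK$ lie in the open unit disc), $\mathbb{V}\subseteq\mathbb{R}^l$, $\mathbb{Z}_f\subseteq\mathbb{R}^n$ and a horizon $N\in\mathbb{N}$, $N\ge1$. At time $j$, for data $x_j\in\mathbb{R}^n$, $z_j\in\mathbb{R}^n$, $E_j\in\mathcal{R}(\Omega,\mathbb{R}^n)$, minimize over $\mathbf{v}=(v_0,\ldots,v_{N-1})\in\mathbb{V}^N$ the cost $\sum_{k=0}^{N-1}\ell(X(k),U(k))+F(X(N))$ subject to: $X(0)=x_j$, $X(k+1)=(A+BK)X(k)+Bv_k+W(j+k)$, $U(k)=KX(k)+v_k$; $z(0)=z_j$, $z(k+1)=(A+BK)z(k)+Bv_k+\mathbb{E}[W(j+k)]$; $E(0)=E_j$, $E(k+1)=(A+BK)E(k)+W(j+k)-\mathbb{E}[W(j+k)]$; $z(N)\in\mathbb{Z}_f$; and for $k=0,\ldots,N-1$: $c_i^\top z(k)\le p_i-\rho(c_i^\top E(k))$ ($i=1,\ldots,m_x$), $d_i^\top(Kz(k)+v_k)\le q_i-\rho(d_i^\top KE(k))$ ($i=1,\ldots,m_u$). The problem is feasible if some $\mathbf{v}$ satisfies all these constraints. Closed-loop algorithm. Initialize $X^{cl}(0)=X_0$, $Z^{cl}(0)=z_0=\mathbb{E}[X_0]$, $E_0=X_0-z_0$. For $j=0,1,\ldots$ and each $\omega$: with $x_j=X^{cl}(j,\omega)$, $z_j=Z^{cl}(j,\omega)$, solve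 the open-loop problem for $(x_j,z_j,E_j)$ to obtain an optimal solution $\mathbf{v}^*=(v_0^*,\ldots,v_{N-1}^* )$ (an optimal solution is presumed to exist whenever the problem is feasible); set $V^{cl}(j,\omega)=v_0^*$, $U^{cl}(j,\omega)=Kx_j+v_0^*$, $Z^{cl}(j+1,\omega)=(A+BK)z_j+Bv_0^*+\mathbb{E}[W(j)]$, $X^{cl}(j+1,\omega)=Ax_j+BU^{cl}(j,\omega)+W(j,\omega)$; and, as random variable, $E_{j+1}=(A+BK)E_j+W(j)-\mathbb{E}[W(j)]$. The controls are chosen measurably, so that $U^{cl}(j)$ and $Z^{cl}(j+1)$ are measurable with respect to $\sigma(X^{cl}(0),\ldots,X^{cl}(j))$. *)

(* Defs.v *)
From mathcomp Require Import all_boot all_order all_algebra finmap.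
From mathcomp Require Import complex.
From mathcomp Require Import all_classical all_reals all_analysis.

Set Implicit Arguments.
Unset Strict Implicit.
Unset Printing Implicit Defensive.

Import Order.TTheory GRing.Theory Num.Theory.
Import numFieldNormedType.Exports.

Local Open Scope classical_set_scope.
Local Open Scope ring_scope.

Definition borel (R : realType) (n : nat) : set (set 'cV[R]_n) :=
  <<s [set O : set 'cV[R]_n | open O] >>.

(* sigma(X), for an arbitrary map X. *)
Definition sigma_rv (T : Type) (R : realType) (n : nat)
    (X : T -> 'cV[R]_n) : set (set T) :=
  preimage_set_system [set: T] X (borel (R := R) (n := n)).

(* A random vector is a plain function with sigma(X) included in the
   sigma-algebra of the probability space. *)
Definition random_vector (disp : measure_display) (T : measurableType disp)
    (R : realType) (n : nat) (X : T -> 'cV[R]_n) : Prop :=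
  sigma_rv X `<=` measurable.

(* F_k = sigma(X(0), ..., X(k)). *)
Definition history (T : Type) (R : realType) (n : nat)
    (X : nat -> T -> 'cV[R]_n) (k : nat) : set (set T) :=
  <<s \bigcup_(i in [set i | (i <= k)%N]) sigma_rv (X i) >>.

Definition integrable_vector (disp : measure_display) (T : measurableType disp)
    (R : realType) (P : probability T R) (n : nat)
    (X : T -> 'cV[R]_n) : Prop :=
  forall i : 'I_n, P.-integrable [set: T] (EFin \o (fun w => X w i 0)).

(* Only meaningful for integrable vectors: [fine] maps infinities to 0. *)
Definition mean (disp : measure_display) (T : measurableType disp)
    (R : realType) (P : probability T R) (n : nat)
    (X : T -> 'cV[R]_n) : 'cV[R]_n :=
  \col_i fine 'E_P[fun w => X w i 0].

Definition same_law_vector (disp : measure_display) (T : measurableType disp)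
    (R : realType) (P : probability T R) (n : nat)
    (X Y : T -> 'cV[R]_n) : Prop :=
  forall B, borel B -> P (X @^-1` B) = P (Y @^-1` B).

Definition same_law (disp : measure_display) (T : measurableType disp)
    (R : realType) (P : probability T R) (X Y : T -> R) : Prop :=
  forall B : set R, measurable B -> P (X @^-1` B) = P (Y @^-1` B).

Definition independent (disp : measure_display) (T : measurableType disp)
    (R : realType) (P : probability T R) (F G : set (set T)) : Prop :=
  forall A B, F A -> G B -> P (A `&` B) = (P A * P B)%E.

Definition mutually_independent (disp : measure_display)
    (T : measurableType disp) (R : realType) (P : probability T R) (n : nat)
    (W : nat -> T -> 'cV[R]_n) : Prop :=
  forall (J : {fset nat}) (A : nat -> set T),
    (forall k, k \in J -> sigma_rv (W k) (A k)) ->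
    P (\bigcap_(k in [set` J]) A k) = (\prod_(k <- J) P (A k))%E.

(* A risk measure is only relevant on random variables: [rho] is a total
   function on maps T -> R, but nothing is required outside the measurable
   ones.  It never takes the value -oo there. *)
Record risk_measure (disp : measure_display) (T : measurableType disp)
    (R : realType) (P : probability T R) (rho : (T -> R) -> \bar R) : Prop :=
  RiskMeasure {
  risk_gtNy : forall Y, measurable_fun [set: T] Y -> (-oo < rho Y)%E;
  risk_translative : forall (Y : T -> R) (c : R), measurable_fun [set: T] Y ->
    rho (fun w => Y w + c) = (rho Y + c%:E)%E;
  risk_monotone : forall Y1 Y2 : T -> R,
    measurable_fun [set: T] Y1 -> measurable_fun [set: T] Y2 ->
    {ae P, forall w, Y2 w <= Y1 w} -> (rho Y2 <= rho Y1)%E;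
  risk_law_invariant : forall Y1 Y2 : T -> R,
    measurable_fun [set: T] Y1 -> measurable_fun [set: T] Y2 ->
    same_law P Y1 Y2 -> rho Y1 = rho Y2 }.

Definition dot (R : realType) (n : nat) (c x : 'cV[R]_n) : R :=
  (c^T *m x) 0 0.

(* Every state can be steered to every other one in finitely many steps. *)
Definition controllable (R : realType) (n l : nat)
    (A : 'M[R]_n) (B : 'M[R]_(n, l)) : Prop :=
  forall x x' : 'cV[R]_n, exists (k : nat) (s : nat -> 'cV[R]_n)
    (u : nat -> 'cV[R]_l),
    [/\ s 0 = x, forall i, s i.+1 = A *m s i + B *m u i & s k = x'].

Definition schur_stable (R : realType) (n : nat) (M : 'M[R]_n) : Prop :=
  forall lambda : R[i],
    eigenvalue (map_mx (real_complex R) M) lambda -> `|lambda| < 1.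

Record mpc_data (T : Type) (R : realType) (n l mx mu : nat) := MpcData {
  sysA : 'M[R]_n;
  sysB : 'M[R]_(n, l);
  noise : nat -> T -> 'cV[R]_n;               (* W *)
  init : T -> 'cV[R]_n;                       (* X_0 *)
  stage_cost : 'cV[R]_n * 'cV[R]_l -> R;      (* g *)
  terminal_cost : 'cV[R]_n -> R;              (* g_f *)
  risk : (T -> R) -> \bar R;                  (* rho *)
  state_dir : 'I_mx -> 'cV[R]_n;              (* c_i *)
  state_bnd : 'I_mx -> R;                     (* p_i *)
  input_dir : 'I_mu -> 'cV[R]_l;              (* d_i *)
  input_bnd : 'I_mu -> R;                     (* q_i *)
  gain : 'M[R]_(l, n);                        (* K *)
  inputs : set 'cV[R]_l;                      (* the set of the v_k *)
  terminal_set : set 'cV[R]_n;                (* Z_f *)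
  horizon : nat                               (* N *)
}.

Definition closedA (T : Type) (R : realType) (n l mx mu : nat)
    (pb : mpc_data T R n l mx mu) : 'M[R]_n := sysA pb + sysB pb *m gain pb.

(* (X, U) is a solution of the system under some adapted control. *)
Definition admissible_process (T : Type) (R : realType) (n l mx mu : nat)
    (pb : mpc_data T R n l mx mu)
    (X : nat -> T -> 'cV[R]_n) (U : nat -> T -> 'cV[R]_l) : Prop :=
  [/\ forall w, X 0 w = init pb w,
      forall k w, X k.+1 w = sysA pb *m X k w + sysB pb *m U k w + noise pb k w
    & forall k, sigma_rv (U k) `<=` history X k].

Record mpc_assumptions (disp : measure_display) (T : measurableType disp)
    (R : realType) (P : probability T R) (n l mx mu : nat)
    (pb : mpc_data T R n l mx mu) : Prop := MpcAssumptions {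
  asm_controllable : controllable (sysA pb) (sysB pb);
  asm_stabilizing : schur_stable (closedA pb);
  asm_horizon : (0 < horizon pb)%N;
  asm_init : random_vector (init pb);
  asm_init_mean : integrable_vector P (init pb);
  asm_noise : forall k, random_vector (noise pb k);
  asm_noise_mean : forall k, integrable_vector P (noise pb k);
  asm_noise_indep : mutually_independent P (noise pb);
  asm_noise_law : forall k, same_law_vector P (noise pb k) (noise pb 0);
  asm_noise_state : forall X U, admissible_process pb X U -> forall k,
    independent P (sigma_rv (noise pb k)) (sigma_rv (X k));
  asm_noise_input : forall X U, admissible_process pb X U ->
    forall k (U' : T -> 'cV[R]_l), sigma_rv U' `<=` history X k ->
    independent P (sigma_rv (noise pb k)) (sigma_rv U');
  asm_cost_continuous : continuous (stage_cost pb);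
  asm_cost_bounded : exists b : R, forall y, b <= stage_cost pb y;
  asm_risk : risk_measure P (risk pb) }.

(* As v ranges over N-tuples, [v`_k] is the k-th entry for k < N; the three
   trajectories below are only used up to time N. *)

Fixpoint olp_state (T : Type) (R : realType) (n l mx mu : nat)
    (pb : mpc_data T R n l mx mu) (j : nat) (x : 'cV[R]_n)
    (v : (horizon pb).-tuple 'cV[R]_l) (k : nat) : T -> 'cV[R]_n :=
  if k is k'.+1 then fun w =>
    closedA pb *m olp_state j x v k' w + sysB pb *m v`_k' + noise pb (j + k') w
  else fun _ => x.
Arguments olp_state {T R n l mx mu} pb j x v k _.

Definition olp_input (T : Type) (R : realType) (n l mx mu : nat)
    (pb : mpc_data T R n l mx mu) (j : nat) (x : 'cV[R]_n)
    (v : (horizon pb).-tuple 'cV[R]_l) (k : nat) : T -> 'cV[R]_l :=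
  fun w => gain pb *m olp_state pb j x v k w + v`_k.
Arguments olp_input {T R n l mx mu} pb j x v k _.

Fixpoint olp_nominal (disp : measure_display) (T : measurableType disp)
    (R : realType) (P : probability T R) (n l mx mu : nat)
    (pb : mpc_data T R n l mx mu) (j : nat) (z : 'cV[R]_n)
    (v : (horizon pb).-tuple 'cV[R]_l) (k : nat) : 'cV[R]_n :=
  if k is k'.+1 then
    closedA pb *m olp_nominal P j z v k' + sysB pb *m v`_k'
      + mean P (noise pb (j + k'))
  else z.
Arguments olp_nominal {disp T R} P {n l mx mu} pb j z v k.

Fixpoint olp_error (disp : measure_display) (T : measurableType disp)
    (R : realType) (P : probability T R) (n l mx mu : nat)
    (pb : mpc_data T R n l mx mu) (j : nat) (E : T -> 'cV[R]_n)
    (k : nat) : T -> 'cV[R]_n :=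
  if k is k'.+1 then fun w =>
    closedA pb *m olp_error P pb j E k' w + noise pb (j + k') w
      - mean P (noise pb (j + k'))
  else E.
Arguments olp_error {disp T R} P {n l mx mu} pb j E k _.

(* Extended-real valued: g is only bounded from below, so the expected stage
   cost may be +oo. *)
Definition olp_cost (disp : measure_display) (T : measurableType disp)
    (R : realType) (P : probability T R) (n l mx mu : nat)
    (pb : mpc_data T R n l mx mu) (j : nat) (x : 'cV[R]_n)
    (v : (horizon pb).-tuple 'cV[R]_l) : \bar R :=
  (\sum_(0 <= k < horizon pb)
      'E_P[fun w => stage_cost pb (olp_state pb j x v k w, olp_input pb j x v k w)]
    + 'E_P[fun w => terminal_cost pb (olp_state pb j x v (horizon pb) w)])%E.
Arguments olp_cost {disp T R} P {n l mx mu} pb j x v.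

(* v is admissible for the data (x, z, E) at time j.  The measured state x is
   part of the data but enters the problem through the cost only. *)
Record olp_admissible (disp : measure_display) (T : measurableType disp)
    (R : realType) (P : probability T R) (n l mx mu : nat)
    (pb : mpc_data T R n l mx mu) (j : nat) (x z : 'cV[R]_n)
    (E : T -> 'cV[R]_n) (v : (horizon pb).-tuple 'cV[R]_l) : Prop :=
  OlpAdmissible {
  olp_inputs : forall k, (k < horizon pb)%N -> inputs pb v`_k;
  olp_terminal : terminal_set pb (olp_nominal P pb j z v (horizon pb));
  olp_state_constraint : forall k (i : 'I_mx), (k < horizon pb)%N ->
    ((dot (state_dir pb i) (olp_nominal P pb j z v k))%:E <=
     (state_bnd pb i)%:E
       - risk pb (fun w => dot (state_dir pb i) (olp_error P pb j E k w)))%E;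
  olp_input_constraint : forall k (i : 'I_mu), (k < horizon pb)%N ->
    ((dot (input_dir pb i) (gain pb *m olp_nominal P pb j z v k + v`_k))%:E <=
     (input_bnd pb i)%:E
       - risk pb (fun w =>
           dot (input_dir pb i) (gain pb *m olp_error P pb j E k w)))%E }.
Arguments olp_admissible {disp T R} P {n l mx mu} pb j x z E v.

Definition olp_feasible (disp : measure_display) (T : measurableType disp)
    (R : realType) (P : probability T R) (n l mx mu : nat)
    (pb : mpc_data T R n l mx mu) (j : nat) (x z : 'cV[R]_n)
    (E : T -> 'cV[R]_n) : Prop :=
  exists v, olp_admissible P pb j x z E v.
Arguments olp_feasible {disp T R} P {n l mx mu} pb j x z E.

Definition olp_optimal (disp : measure_display) (T : measurableType disp)
    (R : realType) (P : probability T R) (n l mx mu : nat)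
    (pb : mpc_data T R n l mx mu) (j : nat) (x z : 'cV[R]_n)
    (E : T -> 'cV[R]_n) (v : (horizon pb).-tuple 'cV[R]_l) : Prop :=
  olp_admissible P pb j x z E v /\
  forall v', olp_admissible P pb j x z E v' ->
    (olp_cost P pb j x v <= olp_cost P pb j x v')%E.
Arguments olp_optimal {disp T R} P {n l mx mu} pb j x z E v.

(* E_j; it does not depend on the controls. *)
Fixpoint cl_error (disp : measure_display) (T : measurableType disp)
    (R : realType) (P : probability T R) (n l mx mu : nat)
    (pb : mpc_data T R n l mx mu) (j : nat) : T -> 'cV[R]_n :=
  if j is j'.+1 then fun w =>
    closedA pb *m cl_error P pb j' w + noise pb j' w - mean P (noise pb j')
  else fun w => init pb w - mean P (init pb).

(* [v j w] is the optimal solution selected at time j for the realization w,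
   so that V^cl(j, w) is its first entry.  Optimality is demanded only where
   the problem is feasible; elsewhere [v j w] is arbitrary. *)
Record closed_loop (disp : measure_display) (T : measurableType disp)
    (R : realType) (P : probability T R) (n l mx mu : nat)
    (pb : mpc_data T R n l mx mu)
    (X Z : nat -> T -> 'cV[R]_n) (U : nat -> T -> 'cV[R]_l)
    (v : nat -> T -> (horizon pb).-tuple 'cV[R]_l) : Prop := ClosedLoop {
  cl_state0 : forall w, X 0 w = init pb w;
  cl_nominal0 : forall w, Z 0 w = mean P (init pb);
  cl_optimal : forall j w,
    olp_feasible P pb j (X j w) (Z j w) (cl_error P pb j) ->
    olp_optimal P pb j (X j w) (Z j w) (cl_error P pb j) (v j w);
  cl_input : forall j w, U j w = gain pb *m X j w + (v j w)`_0;
  cl_nominalS : forall j w, Z j.+1 w =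
    closedA pb *m Z j w + sysB pb *m (v j w)`_0 + mean P (noise pb j);
  cl_stateS : forall j w, X j.+1 w =
    sysA pb *m X j w + sysB pb *m U j w + noise pb j w;
  cl_input_adapted : forall j, sigma_rv (U j) `<=` history X j;
  cl_nominal_adapted : forall j, sigma_rv (Z j.+1) `<=` history X j }.
Arguments closed_loop {disp T R} P {n l mx mu} pb X Z U v.

(* Main.v *)
Require Import Defs.
From mathcomp Require Import all_boot all_order all_algebra finmap.
From mathcomp Require Import all_classical all_reals all_analysis.
From mathcomp Require Import measurable_realfun.

Set Implicit Arguments.
Unset Strict Implicit.
Unset Printing Implicit Defensive.

Import Order.TTheory GRing.Theory Num.Theory.
Import numFieldNormedType.Exports.

Local Open Scope classical_set_scope.
Local Open Scope ring_scope.

(** Recursive feasibility follows from the usual shifted candidate: drop the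
    applied first input and append the terminal input [v_f].  The shifted input
    sequence follows the same nominal and error trajectories, so only the last
    step is new; there the tightening by the supremum over all [E_j] in the
    terminal conditions dominates the tightening actually required. *)

(** Coordinates are continuous and open intervals generate the Borel sets of the line, so it
    suffices that preimages of open intervals are open. *)
Lemma borel_preimage_coord (R : realType) (n : nat) (i : 'I_n) (B : set R) :
  measurable B -> borel ((fun x : 'cV[R]_n => x i 0) @^-1` B).
Proof.
set G := [set O : set 'cV[R]_n | open O].
have mf : measurable_fun [set: g_sigma_algebraType G]
    (fun x : g_sigma_algebraType G => (x : 'cV[R]_n) i 0).
  apply: (measurability _ (RGenOpens.measurableE R)).
  move=> _ [_ [a [b ->]] <-]; rewrite setTI; apply: sub_sigma_algebra => /=.
  apply: (@open_comp _ _ (fun x : 'cV[R]_n => x i 0)).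
    by move=> x _; exact: coord_continuous.
  exact: interval_open.
by move=> mB; have := mf measurableT B mB; rewrite setTI.
Qed.

Section Laws.
Context (disp : measure_display) (T : measurableType disp) (R : realType).
Variable P : probability T R.

Lemma same_law_coord (n : nat) (X Y : T -> 'cV[R]_n) (i : 'I_n) :
  same_law_vector P X Y ->
  same_law P (fun w => X w i 0) (fun w => Y w i 0).
Proof. by move=> XY B mB; exact: XY (borel_preimage_coord i mB). Qed.

(** An expectation is the integral of the identity against the pushforward measure, which the law
    determines. *)
Lemma expectation_same_law (X Y : T -> R) :
  P.-integrable [set: T] (EFin \o X) -> P.-integrable [set: T] (EFin \o Y) ->
  same_law P X Y -> ('E_P[X] = 'E_P[Y])%E.
Proof.
move=> iX iY XY; rewrite unlock.
have mX : measurable_fun setT X by apply/measurable_EFinP; case/integrableP: iX.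
have mY : measurable_fun setT Y by apply/measurable_EFinP; case/integrableP: iY.
have push Z (mZ : measurable_fun setT Z) : P.-integrable setT (EFin \o Z) ->
    (\int[P]_w (Z w)%:E = \int[pushforward P Z]_y y%:E)%E.
  by move=> iZ; rewrite (integral_pushforward mZ) ?preimage_setT.
rewrite (push _ mX iX) (push _ mY iY).
by apply: eq_measure_integral => B mB _; exact: XY.
Qed.

(** Used for the noise: the terminal condition is stated with the mean of [noise pb 0] but is
    applied at time [j + horizon pb]. *)
Lemma mean_same_law (n : nat) (X Y : T -> 'cV[R]_n) :
  integrable_vector P X -> integrable_vector P Y -> same_law_vector P X Y ->
  mean P X = mean P Y.
Proof.
move=> iX iY XY; apply/colP => i; rewrite !mxE.
by rewrite (expectation_same_law (iX i) (iY i) (same_law_coord i XY)).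
Qed.

End Laws.

Section OpenLoop.
Context (disp : measure_display) (T : measurableType disp) (R : realType).
Context (P : probability T R) (n l mx mu : nat) (pb : mpc_data T R n l mx mu).

(** The error recursion is free of controls, so the tightening depends only on the absolute time
    [j + k]. *)
Lemma olp_error_cl_error (j k : nat) :
  olp_error P pb j (cl_error P pb j) k = cl_error P pb (j + k).
Proof.
by elim: k => [|k IH]; rewrite ?addn0// addnS /= IH.
Qed.

(** Both sides run the same recursion with the same inputs and noise means at equal absolute times;
    the first step of [v] is absorbed into the new initial value. *)
Lemma olp_nominal_shift (j k : nat) (z : 'cV[R]_n)
    (v v' : (horizon pb).-tuple 'cV[R]_l) :
  (forall i, (i < k)%N -> v'`_i = v`_i.+1) ->
  olp_nominal P pb j.+1
    (closedA pb *m z + sysB pb *m v`_0 + mean P (noise pb j)) v' k =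
  olp_nominal P pb j z v k.+1.
Proof.
elim: k => [|k IH] vE; first by rewrite /= addn0.
by rewrite /= in IH *; rewrite IH ?vE ?addSnnS// => i ik; exact/vE/ltnW.
Qed.

Lemma shift_tupleP (N : nat) (v : N.-tuple 'cV[R]_l) (vf : 'cV[R]_l) :
  (0 < N)%N -> size (rcons (behead v) vf) == N.
Proof. by move=> N0; rewrite size_rcons size_behead size_tuple prednK. Qed.

Lemma nth_shift (N k : nat) (v : N.-tuple 'cV[R]_l) (vf : 'cV[R]_l) :
  (0 < N)%N -> (k < N)%N ->
  (rcons (behead v) vf)`_k = if (k.+1 < N)%N then v`_k.+1 else vf.
Proof.
move=> N0 kN; rewrite nth_rcons size_behead size_tuple nth_behead ltn_predRL.
(* Here [k] is the last index [N.-1], exactly where [vf] was appended. *)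
by case: ltnP => // Nk; rewrite ifT// eq_sym -eqSS prednK// eqn_leq Nk kN.
Qed.

Hypothesis meanE : forall k, mean P (noise pb k) = mean P (noise pb 0).
Hypothesis N_gt0 : (0 < horizon pb)%N.
Hypothesis terminal_state : forall z, terminal_set pb z -> forall i : 'I_mx,
  ((dot (state_dir pb i) z)%:E <= (state_bnd pb i)%:E
     - ereal_sup (range (fun j : nat =>
         risk pb (fun w => dot (state_dir pb i) (cl_error P pb j w)))))%E.
Variable vf : 'cV[R]_l.
Hypothesis vf_input : inputs pb vf.
Hypothesis terminal_vf : forall z, terminal_set pb z ->
  terminal_set pb (closedA pb *m z + sysB pb *m vf + mean P (noise pb 0)) /\
  forall i : 'I_mu,
    ((dot (input_dir pb i) (gain pb *m z + vf))%:E <= (input_bnd pb i)%:E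
       - ereal_sup (range (fun j : nat => risk pb (fun w =>
           dot (input_dir pb i) (gain pb *m cl_error P pb j w)))))%E.

(** The constraints see only the nominal state and the error, so [x'] may be whatever state the
    disturbance produces. *)
Lemma olp_admissible_shift (j : nat) (x x' z : 'cV[R]_n)
    (v : (horizon pb).-tuple 'cV[R]_l) :
  olp_admissible P pb j x z (cl_error P pb j) v ->
  olp_admissible P pb j.+1 x'
    (closedA pb *m z + sysB pb *m v`_0 + mean P (noise pb j))
    (cl_error P pb j.+1) (Tuple (shift_tupleP v vf N_gt0)).
Proof.
move=> [vin vterm vstate vinput]; set v' := Tuple _.
set z' := (X in olp_admissible P pb j.+1 x' X).
have v'E k : (k < horizon pb)%N ->
    v'`_k = if (k.+1 < horizon pb)%N then v`_k.+1 else vf.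
  exact: nth_shift.
have nomE k : (k < horizon pb)%N ->
    olp_nominal P pb j.+1 z' v' k = olp_nominal P pb j z v k.+1.
  move=> kN; apply: olp_nominal_shift => i ik.
  by rewrite v'E ?(ltn_trans ik)// (leq_ltn_trans ik kN).
(* The two bounds force [k.+1 = horizon pb], the end of the old nominal trajectory. *)
have termE k : (k < horizon pb)%N -> (horizon pb <= k.+1)%N ->
    terminal_set pb (olp_nominal P pb j z v k.+1).
  move=> kN Nk; rewrite (_ : k.+1 = horizon pb)//.
  by apply/eqP; rewrite eqn_leq Nk kN.
have supB (c : R) (b : \bar R) (f : nat -> \bar R) m :
    (b <= c%:E - ereal_sup (range f) -> b <= c%:E - f m)%E.
  move=> /le_trans; apply; apply: leeB => //.
  by apply: ereal_sup_ubound; exists m.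
split=> [k kN||k i kN|k i kN].
- by rewrite v'E//; case: ltnP => // kN'; exact: vin.
(* Writing the horizon as a successor exposes the last step, which applies [vf] at the old terminal
   state. *)
- have NE := prednK N_gt0.
  have NN : ((horizon pb).-1 < horizon pb)%N by rewrite NE.
  rewrite -[X in olp_nominal P pb j.+1 z' v' X]NE /= nomE// v'E// NE ltnn meanE.
  by have [] := terminal_vf (termE _ NN _); rewrite ?NE.
(* Before the last index this is the old constraint at [k.+1]; at the last index the supremum bound
   is specialized to time [j + k.+1]. *)
- rewrite nomE// olp_error_cl_error addSnnS.
  have [kN'|Nk] := ltnP k.+1 (horizon pb).
    by have := vstate _ i kN'; rewrite olp_error_cl_error.
  apply: (supB _ _ (fun m => risk pb (fun w =>
    dot (state_dir pb i) (cl_error P pb m w)))).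
  exact/terminal_state/termE.
- rewrite nomE// olp_error_cl_error addSnnS v'E//.
  have [kN'|Nk] := ltnP k.+1 (horizon pb).
    by have := vinput _ i kN'; rewrite olp_error_cl_error.
  apply: (supB _ _ (fun m => risk pb (fun w =>
    dot (input_dir pb i) (gain pb *m cl_error P pb m w)))).
  exact: (terminal_vf (termE _ kN Nk)).2.
Qed.

End OpenLoop.

Theorem mainTheorem1 (disp : measure_display) (T : measurableType disp)
    (R : realType) (P : probability T R) (n l mx mu : nat)
    (pb : mpc_data T R n l mx mu) (hS : mpc_assumptions P pb)
    (X Z : nat -> T -> 'cV[R]_n) (U : nat -> T -> 'cV[R]_l)
    (v : nat -> T -> (horizon pb).-tuple 'cV[R]_l)
    (hcl : closed_loop P pb X Z U v)
    (hZf0 : terminal_set pb !=set0)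
    (hZf : forall z, terminal_set pb z -> forall i : 'I_mx,
      ((dot (state_dir pb i) z)%:E <= (state_bnd pb i)%:E
         - ereal_sup (range (fun j : nat =>
             risk pb (fun w => dot (state_dir pb i) (cl_error P pb j w)))))%E)
    (hvf : exists vf, inputs pb vf /\ forall z, terminal_set pb z ->
      terminal_set pb
        (closedA pb *m z + sysB pb *m vf + mean P (noise pb 0)) /\
      forall i : 'I_mu,
        ((dot (input_dir pb i) (gain pb *m z + vf))%:E <= (input_bnd pb i)%:E
           - ereal_sup (range (fun j : nat => risk pb (fun w =>
               dot (input_dir pb i) (gain pb *m cl_error P pb j w)))))%E)
    (hfeas0 : forall w,
      olp_feasible P pb 0 (init pb w) (mean P (init pb)) (cl_error P pb 0)) :
  forall (j : nat) (w : T),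
    olp_feasible P pb j (X j w) (Z j w) (cl_error P pb j).
Proof.
have [vf [vf_input terminal_vf]] := hvf.
have meanE k : mean P (noise pb k) = mean P (noise pb 0).
  apply: mean_same_law; [exact: (asm_noise_mean hS)..|].
  exact: (asm_noise_law hS).
elim=> [|j IH] w.
  by rewrite (cl_state0 hcl) (cl_nominal0 hcl); exact: hfeas0.
(* The selected [v j w] is known to be admissible only where the problem is feasible, which the
   induction hypothesis supplies. *)
have [adm _] := cl_optimal hcl (IH w).
(* The closed-loop nominal update is the initial value of the shifted problem, so the shifted tuple
   is the witness. *)
rewrite (cl_nominalS hcl); eexists.
exact: (olp_admissible_shift meanE (asm_horizon hS) hZf vf_input terminal_vf _ adm).
Qed.
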